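(* Let $T>0$. Let $\mathcal{G}:\mathcal{P}_2(\mathbb{R}^d)\to\mathbb{R}$ be $W_2$-Lipschitz continuous and bounded from below. Let $L:\mathbb{R}^d\to\mathbb{R}$ be convex, superlinear, with at most quadratic growth, $L(0)=0$, and such that there exist $C,c>0$ with $L(z)\ge c|z|^2-C$ for all $z\in\mathbb{R}^d$. Let $H(p)=\max_{v\in\mathbb{R}^d}\{\langle -v,p\rangle-L(v)\}$. Then the function $\mathcal{V}:[0,T]\times\mathcal{P}_2(\mathbb{R}^d)\to\mathbb{R}$ given by the Hopf–Lax formula $$\mathcal{V}(t,\mu)=\inf_{\gamma\in\mathcal{P}_{2,\mu}(\mathbb{R}^{2d})}\Big\{\mathcal{G}(\exp_\mu(\gamma))+(T-t)\,\mathcal{L}\Big(\frac{1}{T-t}\cdot\gamma\Big)\Big\}\quad(t<T),\qquad \mathcal{V}(T,\mu)=\mathcal{G}(\mu),$$ is a viscosity solution of $$-\partial_tU(t,\mu)+\int_{\mathbb{R}^d}H(\partial_\mu U(t,\mu,x))\,d\mu(x)=0\quad\text{in }[0,T)\times\mathcal{P}_2(\mathbb{R}^d).$$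
   Context: $\mathcal{P}_2(\mathbb{R}^d)$ is the space of Borel probability measures on $\mathbb{R}^d$ with finite second moment, with the $L^2$-Wasserstein distance $W_2$. A plan on $\mathbb{R}^{2d}$ is optimal if it is an optimal coupling of its marginals for the cost $|x-y|^2$. $\pi_i$ are coordinate projections. For $\mu\in\mathcal{P}_2(\mathbb{R}^d)$: $\mathcal{P}_{2,\mu}(\mathbb{R}^{2d})=\{\gamma\in\mathcal{P}_2(\mathbb{R}^{2d}):(\pi_1)_\#\gamma=\mu\}$; $\exp_\mu(\gamma)=(\pi_1+\pi_2)_\#\gamma$; $\lambda\cdot\gamma=(\pi_1,\lambda\pi_2)_\#\gamma$ for $\lambda\in\mathbb{R}$; $\|\gamma\|_\mu=(\int|y|^2d\gamma(x,y))^{1/2}$. The relaxed Lagrangian is $\mathcal{L}(\gamma)=\int_{\mathbb{R}^{2d}}L(z)\,d\gamma(x,z)$ and the relaxed Hamiltonian is $\mathcal{H}(\gamma)=\int_{\mathbb{R}^{2d}}H(z)\,d\gamma(x,z)$. At most quadratic growth means $|L(z)|\le C'(1+|z|^2)$ for some $C'$. For $\gamma,\xi\in\mathcal{P}_{2,\mu}(\mathbb{R}^{2d})$, $\Gamma_\mu(\gamma,\xi)$ is the set of $\theta\in\mathcal{P}(\mathbb{R}^{3d})$ with $(\pi_1,\pi_2)_\#\theta=\gamma$ and $(\pi_1,\pi_3)_\#\theta=\xi$; $\langle\gamma,\xi\rangle_{\theta,\mu}=\int\langle y,z\rangle d\theta(x,y,z)$; $W_\mu^2(\gamma,\xi)=\min_{\theta\in\Gamma_\mu(\gamma,\xi)}\int|y-z|^2d\theta(x,y,z)$.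 The geometric tangent space $\mathrm{Tan}^K_\mu\mathcal{P}_2(\mathbb{R}^d)$ is the $W_\mu$-closure of the set of $\gamma\in\mathcal{P}_{2,\mu}(\mathbb{R}^{2d})$ such that $(\pi_1,\pi_1+\eta\pi_2)_\#\gamma$ is optimal for some $\eta>0$. For $\phi:[0,T]\times\mathcal{P}_2(\mathbb{R}^d)\to\mathbb{R}$, $(r,\gamma)\in\partial^+\phi(t,\mu)$ means: $r\in\mathbb{R}$, $\gamma\in\mathrm{Tan}^K_\mu\mathcal{P}_2(\mathbb{R}^d)$, and for all $s\in[0,T]$, $\xi\in\mathcal{P}_{2,\mu}(\mathbb{R}^{2d})$ and $\theta\in\Gamma_\mu(\gamma,\xi)$, $\phi(s,\exp_\mu(\xi))-\phi(t,\mu)\le r(s-t)+\langle\gamma,\xi\rangle_{\theta,\mu}+o(|s-t|+\|\xi\|_\mu)$; $\partial^-\phi(t,\mu)$ is defined by the reversed inequality. $U$ is a viscosity subsolution if $-r+\mathcal{H}(\gamma)\le0$ for all $t\in[0,T)$, $\mu\in\mathcal{P}_2(\mathbb{R}^d)$, $(r,\gamma)\in\partial^+U(t,\mu)$; a viscosity supersolution if $-r+\mathcal{H}(\gamma)\ge0$ for all $t\in[0,T)$, $\mu\in\mathcal{P}_2(\mathbb{R}^d)$, $(r,\gamma)\in\partial^-U(t,\mu)$; a viscosity solution if it is both. *)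

(* Defs.v *)
(* R^d is 'rV[R]_d, for R : realType, with its Borel sigma-algebra. *)
From HB Require Import structures.
From mathcomp Require Import all_boot all_order all_algebra.
From mathcomp Require Import all_classical all_reals all_analysis measurable_realfun.
Set Implicit Arguments.
Unset Strict Implicit.
Unset Printing Implicit Defensive.
Import Order.TTheory GRing.Theory Num.Theory.
Import numFieldNormedType.Exports.
Local Open Scope classical_set_scope.
Local Open Scope ring_scope.

Section borel.
Context {R : realType} {d : nat}.

Definition open_rV : set (set 'rV[R]_d) := [set U | open U].

Let borel0 : <<s open_rV >> set0.
Proof. exact: sigma_algebra0. Qed.

Let borelC A : <<s open_rV >> A -> <<s open_rV >> (~` A).
Proof. exact: sigma_algebraC. Qed.

Let borel_bigcup (F : (set 'rV[R]_d)^nat) :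
  (forall i, <<s open_rV >> (F i)) -> <<s open_rV >> (\bigcup_i F i).
Proof. exact: sigma_algebra_bigcup. Qed.

HB.instance Definition _ := @isMeasurable.Build (sigma_display open_rV)
  'rV[R]_d <<s open_rV >> borel0 borelC borel_bigcup.

Lemma borel_rVE : @measurable _ 'rV[R]_d = <<s @open 'rV[R]_d >>.
Proof. by []. Qed.

Lemma measurable_coord (i : 'I_d) :
  measurable_fun [set: 'rV[R]_d] (fun x : 'rV[R]_d => x ord0 i).
Proof.
apply: (measurability _ (RGenOpens.measurableE R)) => _ [_ [a [b ->] <-]].
rewrite setTI; apply: sub_sigma_algebra.
apply: open_comp; last exact: interval_open.
by move=> x _; exact: coord_continuous.
Qed.

Let cube (c : {ffun 'I_d -> rat * rat}) : set 'rV[R]_d :=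
  [set x | forall i, x ord0 i \in `]ratr (c i).1, ratr (c i).2[].

Let open_cubes (U : set 'rV[R]_d) : open U ->
  U = \bigcup_(c in [set c | cube c `<=` U]) cube c.
Proof.
rewrite openE => oU; apply/seteqP; split=> [x Ux|x [c /= cU /cU//]].
have /nbhs_ballP[e /= e0 eU] := oU x Ux.
have lo i : x ord0 i - e < x ord0 i by rewrite ltrBlDr ltrDl.
have hi i : x ord0 i < x ord0 i + e by rewrite ltrDl.
pose q1 i := xchoose (rat_in_itvoo (lo i)).
pose q2 i := xchoose (rat_in_itvoo (hi i)).
have q1P i : ratr (q1 i) \in `](x ord0 i - e), (x ord0 i)[.
  exact: (xchooseP (rat_in_itvoo (lo i))).
have q2P i : ratr (q2 i) \in `](x ord0 i), (x ord0 i + e)[.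
  exact: (xchooseP (rat_in_itvoo (hi i))).
exists [ffun i => (q1 i, q2 i)]; last first.
  move=> i; rewrite ffunE /= in_itv /=.
  by move: (q1P i) (q2P i); rewrite !in_itv /= => /andP[_ ->] /andP[->].
move=> y cy; apply: eU; split=> // i j; rewrite (ord1 i).
move: (cy j) (q1P j) (q2P j); rewrite ffunE /= !in_itv /=.
move=> /andP[y1 y2] /andP[q11 q12] /andP[q21 q22].
rewrite /ball /= ltr_distlC.
by rewrite (lt_trans q11 y1) (lt_trans y2 q22).
Qed.

Lemma measurable_fun_rV d' (T : measurableType d') (f : T -> 'rV[R]_d) :
  (forall i, measurable_fun setT (fun t => f t ord0 i)) ->
  measurable_fun setT f.
Proof.
move=> mf; apply: (@measurability _ _ _ _ _ _ open_rV) => //.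
move=> _ [U oU <-]; rewrite setTI (open_cubes oU) preimage_bigcup bigcup_mkcond.
apply: countable_bigcupT_measurable.
  exact: countableP.
move=> c; case: ifP => // _; rewrite [X in measurable X](_ : _ =
    \bigcap_(i in [set: 'I_d]) ((fun t => f t ord0 i) @^-1`
       `]ratr (c i).1, ratr (c i).2[)); last first.
  by apply/seteqP; split=> t /= h i => [_|]; exact: h.
apply: fin_bigcap_measurable => // i _.
by rewrite -[X in measurable X]setTI; exact: mf.
Qed.

End borel.

Section euclidean.
Context {R : realType} {d : nat}.
Implicit Types x y : 'rV[R]_d.

Definition dotv x y : R := \sum_i x ord0 i * y ord0 i.

Definition sqnorm x : R := dotv x x.

(* The norm `|x| of the library on 'rV is the sup norm. *)
Definition enorm x : R := Num.sqrt (sqnorm x).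

Lemma measurable_addv : measurable_fun setT
  (fun w : 'rV[R]_d * 'rV[R]_d => w.1 + w.2).
Proof.
apply: measurable_fun_rV => i; under eq_fun do rewrite mxE.
apply: measurable_funD.
- exact: measurableT_comp (measurable_coord i) measurable_fst.
- exact: measurableT_comp (measurable_coord i) measurable_snd.
Qed.

Lemma measurable_scalev (a : R) : measurable_fun setT
  (fun x : 'rV[R]_d => a *: x).
Proof.
apply: measurable_fun_rV => i; under eq_fun do rewrite mxE.
by apply: measurable_funM => //; exact: measurable_coord.
Qed.

(* pi_1 + pi_2 *)
Definition addv (w : 'rV[R]_d * 'rV[R]_d) : 'rV[R]_d := w.1 + w.2.

(* (pi_1, a pi_2) *)
Definition scale2 (a : R) (w : 'rV[R]_d * 'rV[R]_d) : 'rV[R]_d * 'rV[R]_d :=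
  (w.1, a *: w.2).

(* (pi_1, pi_1 + a pi_2) *)
Definition shift2 (a : R) (w : 'rV[R]_d * 'rV[R]_d) : 'rV[R]_d * 'rV[R]_d :=
  (w.1, w.1 + a *: w.2).

HB.instance Definition _ := isMeasurableFun.Build _ _ _ _ addv measurable_addv.

Lemma measurable_scale2 a : measurable_fun setT (scale2 a).
Proof.
apply: measurable_fun_pair; first exact: measurable_fst.
exact: measurableT_comp (measurable_scalev a) measurable_snd.
Qed.

HB.instance Definition _ a :=
  isMeasurableFun.Build _ _ _ _ (scale2 a) (measurable_scale2 a).

Lemma measurable_shift2 a : measurable_fun setT (shift2 a).
Proof.
apply: measurable_fun_pair; first exact: measurable_fst.
exact: measurableT_comp measurable_addv (measurable_scale2 a).
Qed.

HB.instance Definition _ a :=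
  isMeasurableFun.Build _ _ _ _ (shift2 a) (measurable_shift2 a).

End euclidean.

(* A measure is a function on all sets that is only meaningful on the
   measurable ones, hence this form of equality between measures. *)
Definition same_measure dT (T : measurableType dT) (R : realType)
    (m1 m2 : set T -> \bar R) :=
  forall A, measurable A -> m1 A = m2 A.

Section wasserstein.
Context {R : realType} {d : nat}.
Local Notation V := 'rV[R]_d.
Implicit Types (mu nu : probability V R) (gamma xi : probability (V * V)%type R)
  (theta : probability (V * V * V)%type R).

Definition P2 : set (probability V R) :=
  [set mu | (\int[mu]_x (sqnorm x)%:E < +oo)%E].

(* P_2(R^(2d)); R^(2d) is V * V, with |(x, y)|^2 = |x|^2 + |y|^2. *)
Definition P2x2 : set (probability (V * V)%type R) :=
  [set gamma | (\int[gamma]_w (sqnorm w.1 + sqnorm w.2)%:E < +oo)%E].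

Definition couplings mu nu : set (probability (V * V)%type R) :=
  [set s | same_measure (pushforward s fst) mu /\
           same_measure (pushforward s snd) nu].

Definition transport_cost (s : probability (V * V)%type R) : \bar R :=
  (\int[s]_w (sqnorm (w.1 - w.2))%:E)%E.

Definition W2 mu nu : \bar R :=
  sqrte (ereal_inf [set transport_cost s | s in couplings mu nu]).

Definition optimal_plan (s : probability (V * V)%type R) :=
  forall s' : probability (V * V)%type R,
    same_measure (pushforward s' fst) (pushforward s fst) ->
    same_measure (pushforward s' snd) (pushforward s snd) ->
    (transport_cost s <= transport_cost s')%E.

Definition P2mu mu : set (probability (V * V)%type R) :=
  [set gamma | P2x2 gamma /\ same_measure (pushforward gamma fst) mu].

Definition expmu gamma : probability V R := distribution gamma addv.

Definition scale_plan (a : R) gamma : probability (V * V)%type R :=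
  distribution gamma (scale2 a).

Definition plan_norm gamma : R := Num.sqrt (\int[gamma]_w sqnorm w.2).

(* The relaxation of F : R^d -> R to plans, for both L and H. *)
Definition relaxed (F : V -> R) gamma : R := \int[gamma]_w F w.2.

(* In R^(3d) = V * V * V, pi_1, pi_2, pi_3 are w.1.1, w.1.2, w.2. *)
Definition Gamma gamma xi : set (probability (V * V * V)%type R) :=
  [set theta | same_measure (pushforward theta fst) gamma /\
     same_measure (pushforward theta (fun w => (w.1.1, w.2))) xi].

Definition pairing theta : R := \int[theta]_w dotv w.1.2 w.2.

Definition Wmu gamma xi : \bar R :=
  sqrte (ereal_inf
    [set (\int[theta]_w (sqnorm (w.1.2 - w.2))%:E)%E | theta in Gamma gamma xi]).

Definition TanK mu : set (probability (V * V)%type R) :=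
  [set gamma | P2mu mu gamma /\ forall e : R, 0 < e ->
     exists gamma', [/\ P2mu mu gamma',
       exists2 eta : R, 0 < eta & optimal_plan (distribution gamma' (shift2 eta))
       & (Wmu gamma gamma' < e%:E)%E]].

End wasserstein.

Section viscosity.
Context {R : realType} {d : nat}.
Local Notation V := 'rV[R]_d.
Variables (T : R) (phi : R -> probability V R -> R).
Implicit Types (t r : R) (mu : probability V R).

(* Functions on [0, T] x P_2(R^d) are total functions, of which only the values
   on `[0, T] and P2 are used. *)
Definition superdiff t mu : set (R * probability (V * V)%type R) :=
  [set rg | TanK mu rg.2 /\
    forall e : R, 0 < e -> exists2 delta : R, 0 < delta &
    forall s xi theta, s \in `[0, T] -> P2mu mu xi -> Gamma rg.2 xi theta ->
      `|s - t| + plan_norm xi < delta ->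
      phi s (expmu xi) - phi t mu <=
        rg.1 * (s - t) + pairing theta + e * (`|s - t| + plan_norm xi)].

Definition subdiff t mu : set (R * probability (V * V)%type R) :=
  [set rg | TanK mu rg.2 /\
    forall e : R, 0 < e -> exists2 delta : R, 0 < delta &
    forall s xi theta, s \in `[0, T] -> P2mu mu xi -> Gamma rg.2 xi theta ->
      `|s - t| + plan_norm xi < delta ->
      phi s (expmu xi) - phi t mu >=
        rg.1 * (s - t) + pairing theta - e * (`|s - t| + plan_norm xi)].

Variable H : V -> R.

Definition viscosity_subsolution :=
  forall t mu r gamma, t \in `[0, T[ -> P2 mu -> superdiff t mu (r, gamma) ->
    - r + relaxed H gamma <= 0.

Definition viscosity_supersolution :=
  forall t mu r gamma, t \in `[0, T[ -> P2 mu -> subdiff t mu (r, gamma) ->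
    - r + relaxed H gamma >= 0.

Definition viscosity_solution :=
  viscosity_subsolution /\ viscosity_supersolution.

End viscosity.

Section hopf_lax.
Context {R : realType} {d : nat}.
Local Notation V := 'rV[R]_d.

Definition W2_lipschitz (G : probability V R -> R) :=
  exists K : R, forall mu nu, P2 mu -> P2 nu ->
    (`|G mu - G nu|%:E <= K%:E * W2 mu nu)%E.

Definition bounded_below (G : probability V R -> R) :=
  exists m : R, forall mu, P2 mu -> m <= G mu.

(* L z / |z| tends to +oo as |z| tends to +oo. *)
Definition superlinear (L : V -> R) :=
  forall M : R, exists rho : R, forall z, rho < enorm z -> M * enorm z <= L z.

Definition quadratic_growth (L : V -> R) :=
  exists C' : R, forall z, `|L z| <= C' * (1 + enorm z ^+ 2).

(* The supremum is a maximum when L is convex and superlinear. *)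
Definition hamiltonian (L : V -> R) (p : V) : R :=
  sup [set dotv (- v) p - L v | v in [set: V]].

Definition hopf_lax (T : R) (G : probability V R -> R) (L : V -> R)
    (t : R) (mu : probability V R) : R :=
  if t < T then
    inf [set G (expmu gamma) +
             (T - t) * relaxed L (scale_plan (T - t)^-1 gamma)
        | gamma in P2mu mu]
  else G mu.

End hopf_lax.

(* Main.v *)
Require Import Defs.
From mathcomp Require Import all_boot all_order all_algebra.
From mathcomp Require Import all_classical all_reals all_analysis.
From mathcomp Require Import ring lra measurable_realfun.
Import Order.TTheory GRing.Theory Num.Theory.
Import numFieldNormedType.Exports.
Local Open Scope classical_set_scope.
Local Open Scope ring_scope.

Set Implicit Arguments.
Unset Strict Implicit.

(** Both inequalities follow from dynamic programming along plans of constant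
    velocity: over a step [h] the value changes by at most [h] times the relaxed
    Lagrangian, and the Legendre transform turns this into [H] as [h] tends to
    0.  Plans over the same foot measure have to be composed, usually by
    disintegration.  That is avoided here: for a countable partition of R^d into
    small cells, the normalized products of the restrictions to the cells form a
    coupling with the exact marginals whose feet are [e]-close.  The error is
    absorbed by the Lipschitz continuity of [G], because [hopf_lax] is an
    infimum.

    For the subsolution inequality the superdifferential is tested with
    velocities [v(p)], where [v] maximizes [- <v, p> - L v] over the first [n]
    points of a dense sequence; the integral of [H] is the monotone limit.  For
    the supersolution inequality the subdifferential is tested with a plan that
    is optimal up to [e * h], whose norm is bounded by coercivity. *)

(** * Laws of random variables and change of variables *)

Section law.
Context {R : realType} {d1 d2 : measure_display} {Om : measurableType d1}
  {S : measurableType d2}.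
Implicit Types (P : probability Om R) (m : probability S R) (X : Om -> S).

(** Plans below are handled as laws of random variables on one common probability space, up to
    [same_measure]; this supplies a bundled probability for each law. *)
Lemma law_exists P X : measurable_fun setT X ->
  exists m, same_measure (pushforward P X) m.
Proof.
by move=> mX; exists (distribution P (mfun_Sub (mem_set mX : X \in mfun))).
Qed.

Lemma law_ge0_integral P X m F : measurable_fun setT X ->
  same_measure (pushforward P X) m ->
  measurable_fun setT F -> (forall y, 0 <= F y)%E ->
  (\int[m]_y F y = \int[P]_w F (X w))%E.
Proof.
move=> mX Xm mF F0.
pose X' : {RV P >-> S} := mfun_Sub (mem_set mX : X \in mfun).
rewrite -(ge0_integral_distribution X' mF F0).
by apply/esym/eq_measure_integral => A mA _; exact: Xm.
Qed.

(** [Rintegral] is [fine] of the difference between the integrals of the positive and negative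
    parts, and each of these transfers separately. *)
Lemma law_Rintegral P X m (F : S -> R) : measurable_fun setT X ->
  same_measure (pushforward P X) m -> measurable_fun setT F ->
  \int[m]_y F y = \int[P]_w F (X w).
Proof.
move=> mX Xm mF; congr fine.
have mEF : measurable_fun setT (EFin \o F) by exact/measurable_EFinP.
rewrite integralE [RHS]integralE; congr (_ - _)%E.
- rewrite (law_ge0_integral (F := (EFin \o F)^\+%E) mX Xm) //.
    by apply: eq_integral => w _; rewrite !funeposE.
  exact: measurable_funepos.
- rewrite (law_ge0_integral (F := (EFin \o F)^\-%E) mX Xm) //.
    by apply: eq_integral => w _; rewrite !funenegE.
  exact: measurable_funeneg.
Qed.

Lemma law_integrable P X m (F : S -> R) : measurable_fun setT X ->
  same_measure (pushforward P X) m -> measurable_fun setT F ->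
  m.-integrable setT (EFin \o F) <-> P.-integrable setT (EFin \o (F \o X)).
Proof.
move=> mX Xm mF.
have mEF : measurable_fun setT (EFin \o F) by exact/measurable_EFinP.
have mEFX : measurable_fun setT (EFin \o (F \o X)).
  exact: (measurableT_comp mEF).
have E : (\int[m]_y `|(EFin \o F) y| = \int[P]_w `|(EFin \o (F \o X)) w|)%E.
  apply: (law_ge0_integral (F := fun y => `|(EFin \o F) y|%E) mX Xm) => //.
  by apply: measurableT_comp => //; exact: measurable_abse.
by split=> /integrableP[_ H]; apply/integrableP; split=> //; rewrite ?E // -E.
Qed.

End law.

(** * Integrability of real functions on a probability space *)

Section domination.
Context {R : realType} {d : measure_display} {Om : measurableType d}.
Variable P : probability Om R.

Lemma integrable_cstR (a : R) : P.-integrable setT (EFin \o (fun=> a)).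
Proof. exact: finite_measure_integrable_cst. Qed.

Lemma integrable_domR (F G : Om -> R) : measurable_fun setT F ->
  P.-integrable setT (EFin \o G) -> (forall w, `|F w| <= G w) ->
  P.-integrable setT (EFin \o F).
Proof.
move=> mF iG FG; apply: le_integrable iG => //; first exact/measurable_EFinP.
by move=> w _ /=; rewrite lee_fin (le_trans (FG w))// ler_norm.
Qed.

Lemma integrableDR (F G : Om -> R) :
  P.-integrable setT (EFin \o F) -> P.-integrable setT (EFin \o G) ->
  P.-integrable setT (EFin \o (fun w => F w + G w)).
Proof. by move=> iF iG; exact: (integrableD _ iF iG). Qed.

Lemma integrableZR (a : R) (F : Om -> R) :
  P.-integrable setT (EFin \o F) ->
  P.-integrable setT (EFin \o (fun w => a * F w)).
Proof. by move=> iF; exact: (integrableZl _ a iF). Qed.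

Lemma integrableNR (F : Om -> R) :
  P.-integrable setT (EFin \o F) ->
  P.-integrable setT (EFin \o (fun w => - F w)).
Proof. by move=> iF; exact: (integrableN iF). Qed.

Lemma ge0_integrable_lty (F : Om -> R) : measurable_fun setT F ->
  (forall w, 0 <= F w) -> (\int[P]_w (F w)%:E < +oo)%E ->
  P.-integrable setT (EFin \o F).
Proof.
move=> mF F0 H; apply/integrableP; split; first exact/measurable_EFinP.
by apply: le_lt_trans H; under eq_integral do rewrite /= ger0_norm //.
Qed.

Lemma Rintegral_cstT (a : R) : \int[P]_w a = a.
Proof.
rewrite Rintegral_cst //; transitivity (a * fine 1%E); last by rewrite mulr1.
by congr (_ * fine _); exact: probability_setT.
Qed.

End domination.

(** * Euclidean geometry and square-integrable vectors in R^d *)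

Section vectors.
Context {R : realType} {d : nat}.
Local Notation V := 'rV[R]_d.
Implicit Types (x y z : V) (a : R).

Lemma dotvC x y : dotv x y = dotv y x.
Proof. by apply: eq_bigr => i _; rewrite mulrC. Qed.

Lemma dotvDl x y z : dotv (x + y) z = dotv x z + dotv y z.
Proof. by rewrite -big_split; apply: eq_bigr => i _; rewrite mxE mulrDl. Qed.

Lemma dotvZl a x y : dotv (a *: x) y = a * dotv x y.
Proof. by rewrite mulr_sumr; apply: eq_bigr => i _; rewrite mxE mulrA. Qed.

Lemma dotvNl x y : dotv (- x) y = - dotv x y.
Proof. by rewrite -scaleN1r dotvZl mulN1r. Qed.

Lemma dotvDr x y z : dotv x (y + z) = dotv x y + dotv x z.
Proof. by rewrite dotvC dotvDl !(dotvC x). Qed.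

Lemma dotvZr a x y : dotv x (a *: y) = a * dotv x y.
Proof. by rewrite dotvC dotvZl dotvC. Qed.

Lemma dotv0 x : dotv x 0 = 0.
Proof. by rewrite -(scale0r x) dotvZr mul0r. Qed.

Lemma sqnorm_ge0 x : 0 <= sqnorm x.
Proof. by apply: sumr_ge0 => i _; rewrite -expr2 sqr_ge0. Qed.

Lemma sqnormZ a x : sqnorm (a *: x) = a ^+ 2 * sqnorm x.
Proof. by rewrite /sqnorm dotvZl dotvZr mulrA expr2. Qed.

Lemma sqnormD x y : sqnorm (x + y) = sqnorm x + 2 * dotv x y + sqnorm y.
Proof. by rewrite /sqnorm dotvDl !dotvDr (dotvC y x); ring. Qed.

Lemma sqnorm0 : sqnorm (0 : V) = 0.
Proof. exact: dotv0. Qed.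

Lemma enormE x : enorm x ^+ 2 = sqnorm x.
Proof. by rewrite sqr_sqrtr // sqnorm_ge0. Qed.

Lemma sqnormD_le x y : sqnorm (x + y) <= 2 * sqnorm x + 2 * sqnorm y.
Proof.
have := sqnorm_ge0 (x + (-1) *: y); rewrite !sqnormD sqnormZ dotvZr.
by rewrite sqrrN expr1n; lra.
Qed.

(** Expand [|2a x - b y|^2 >= 0] for the signs [b = 1] and [b = -1], then divide by [4a]. *)
Lemma dotv_young a x y : 0 < a ->
  `|dotv x y| <= a * sqnorm x + (4 * a)^-1 * sqnorm y.
Proof.
move=> a0.
have H b : b ^+ 2 = 1 -> b * dotv x y <= a * sqnorm x + (4 * a)^-1 * sqnorm y.
  move=> b1; have := sqnorm_ge0 ((2 * a) *: x + (- b) *: y).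
  rewrite sqnormD !sqnormZ dotvZl dotvZr sqrrN b1 mul1r => H.
  rewrite -(ler_pM2l (_ : 0 < 4 * a)); last lra.
  by rewrite [leRHS]mulrDr mulVKf; [nra|lra].
have := H 1 (expr1n _ _); have := H (-1); rewrite sqrrN expr1n mul1r mulN1r.
by rewrite ler_norml => /(_ erefl) h1 h2; apply/andP; split; lra.
Qed.

Lemma dotv_le x y : `|dotv x y| <= sqnorm x + sqnorm y.
Proof.
have := dotv_young x y (ltr01 : 0 < 1 :> R); have := sqnorm_ge0 y.
by rewrite mul1r mulr1; lra.
Qed.

(** Compares the Euclidean norm with the sup norm, whose balls define the topology. *)
Lemma sqnorm_le_coord x (s : R) : (forall i, `|x ord0 i| <= s) ->
  sqnorm x <= d%:R * s ^+ 2.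
Proof.
move=> xs; apply: (@le_trans _ _ (\sum_(i < d) s ^+ 2)); last first.
  by rewrite sumr_const card_ord mulr_natl.
apply: ler_sum => i _; rewrite -expr2 -real_normK ?num_real //.
by rewrite lerXn2r // nnegrE (le_trans _ (xs i)).
Qed.

Lemma rV_dense_seq : exists q : nat -> V,
  forall x (s : R), 0 < s -> exists n, forall i, `|q n ord0 i - x ord0 i| < s.
Proof.
pose r (c : {ffun 'I_d -> rat}) : V := \row_i ratr (c i).
(* Integers that encode no rational vector are sent to 0. *)
exists (fun n => oapp r 0 (unpickle n)) => x s s0.
have lo i : x ord0 i < x ord0 i + s by rewrite ltrDl.
pose c : {ffun 'I_d -> rat} := [ffun i => xchoose (rat_in_itvoo (lo i))].
exists (pickle c) => i; rewrite pickleK /= mxE ffunE.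
have := xchooseP (rat_in_itvoo (lo i)).
by rewrite in_itv /= => /andP[h1 h2]; rewrite gtr0_norm; lra.
Qed.

Context {dO : measure_display} {Om : measurableType dO}.
Implicit Types X Y : Om -> V.

Lemma measurable_dotv X Y : measurable_fun setT X -> measurable_fun setT Y ->
  measurable_fun setT (fun w => dotv (X w) (Y w)).
Proof.
move=> mX mY; apply: measurable_sum => i; apply: measurable_funM.
- exact: measurableT_comp (measurable_coord i) mX.
- exact: measurableT_comp (measurable_coord i) mY.
Qed.

Lemma measurable_sqnorm X : measurable_fun setT X ->
  measurable_fun setT (fun w => sqnorm (X w)).
Proof. by move=> mX; exact: measurable_dotv. Qed.

Lemma measurable_rVD X Y : measurable_fun setT X -> measurable_fun setT Y ->
  measurable_fun setT (fun w => X w + Y w).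
Proof.
move=> mX mY; apply: measurable_fun_rV => i; under eq_fun do rewrite mxE.
apply: measurable_funD.
- exact: measurableT_comp (measurable_coord i) mX.
- exact: measurableT_comp (measurable_coord i) mY.
Qed.

Lemma measurable_rVZ a X : measurable_fun setT X ->
  measurable_fun setT (fun w => a *: X w).
Proof. by move=> mX; exact: measurableT_comp (measurable_scalev a) mX. Qed.

Lemma measurable_rVB X Y : measurable_fun setT X -> measurable_fun setT Y ->
  measurable_fun setT (fun w => X w - Y w).
Proof.
move=> mX mY; under eq_fun do rewrite -scaleN1r.
by apply: measurable_rVD => //; exact: measurable_rVZ.
Qed.

Variable P : probability Om R.

Definition sqint X := P.-integrable setT (EFin \o (fun w => sqnorm (X w))).

Lemma sqintD X Y : measurable_fun setT X -> measurable_fun setT Y ->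
  sqint X -> sqint Y -> sqint (fun w => X w + Y w).
Proof.
move=> mX mY iX iY.
apply: (@integrable_domR _ _ _ P _ (fun w => 2 * sqnorm (X w) + 2 * sqnorm (Y w))).
- by apply: measurable_sqnorm; exact: measurable_rVD.
- by apply: integrableDR; exact: integrableZR.
- by move=> w; rewrite ger0_norm ?sqnorm_ge0 // sqnormD_le.
Qed.

Lemma sqintZ a X : sqint X -> sqint (fun w => a *: X w).
Proof.
move=> iX; rewrite /sqint; under eq_fun do rewrite sqnormZ.
exact: integrableZR.
Qed.

Lemma integrable_dotv X Y : measurable_fun setT X -> measurable_fun setT Y ->
  sqint X -> sqint Y ->
  P.-integrable setT (EFin \o (fun w => dotv (X w) (Y w))).
Proof.
move=> mX mY iX iY.
apply: (@integrable_domR _ _ _ P _ (fun w => sqnorm (X w) + sqnorm (Y w))).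
- exact: measurable_dotv.
- exact: integrableDR.
- by move=> w; exact: dotv_le.
Qed.

Lemma sqint_lty X : measurable_fun setT X ->
  (\int[P]_w (sqnorm (X w))%:E < +oo)%E <-> sqint X.
Proof.
move=> mX; split=> [H|iX].
- apply: ge0_integrable_lty H => [|w]; last exact: sqnorm_ge0.
  exact: measurable_sqnorm.
- have /= := integrable_lty measurableT iX; apply: le_lt_trans.
  by under eq_integral do [].
Qed.

End vectors.

(** * Upper semicontinuity of a convex Lagrangian *)

Section lagrangian.
Context {R : realType} {d : nat}.
Local Notation V := 'rV[R]_d.
Variable L : V -> R.
Hypothesis L_conv : forall (t : R) (x y : V), 0 <= t <= 1 ->
  L (t *: x + (1 - t) *: y) <= t * L x + (1 - t) * L y.
Variable B : R.
Hypothesis L_quad : forall z, `|L z| <= B * (1 + sqnorm z).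

(** The point [w] lies on the segment from [v] to [v + s^-1 (w - v)], which stays in the unit
    sup-norm ball around [v], where [L <= M]. Convexity then gives [L w <= L v + s (M - L v)], and
    [s] is small enough for the last term to be at most [e]. *)
Lemma lagrangian_usc (v : V) (e : R) : 0 < e -> exists2 s : R, 0 < s &
  forall w : V, (forall i, `|w ord0 i - v ord0 i| < s) -> L w <= L v + e.
Proof.
(* On that ball [|z|^2 <= 2 |v|^2 + 2 d], so [M] comes from the quadratic growth. *)
move=> e0; set M := B * (1 + 2 * sqnorm v + 2 * d%:R).
have B0 : 0 <= B.
  have := le_trans (normr_ge0 _) (L_quad 0).
  by rewrite sqnorm0 addr0 mulr1.
have d0 : 0 <= d%:R :> R by [].
have M0 : 0 <= M by rewrite mulr_ge0 // ; have := sqnorm_ge0 v; lra.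
have K0 : 0 < M + `|L v| + 1 by have := normr_ge0 (L v); lra.
exists (Num.min 1 (e / (M + `|L v| + 1))).
  by rewrite lt_min ltr01 divr_gt0.
set s := Num.min 1 _ => w ws.
have s0 : 0 < s by rewrite lt_min ltr01 divr_gt0.
have s1 : s <= 1 by rewrite ge_min lexx.
have se : s * (M + `|L v| + 1) <= e.
  by rewrite -ler_pdivlMr // ge_min lexx orbT.
have Lu : L (v + s^-1 *: (w - v)) <= M.
  apply: le_trans (ler_norm _) _; apply: le_trans (L_quad _) _.
  rewrite ler_wpM2l // -addrA lerD2l; apply: le_trans (sqnormD_le _ _) _.
  rewrite lerD2l ler_pM2l //.
  rewrite -[leRHS]mulr1 -[X in _ * X](expr1n _ 2).
  apply: sqnorm_le_coord => i; rewrite !mxE normrM gtr0_norm ?invr_gt0 //.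
  by rewrite mulrC ler_pdivrMr // mul1r ltW.
have -> : w = s *: (v + s^-1 *: (w - v)) + (1 - s) *: v.
  rewrite scalerDr scalerA mulfV ?gt_eqF // scale1r scalerBl scale1r.
  by rewrite addrC addrA subrK addrC subrK.
apply: le_trans (L_conv _ _ _) _; first by rewrite ltW.
have := ler_norm (- L v); rewrite normrN.
nra.
Qed.

(** By upper semicontinuity the sets [L < a] are open, and they generate. *)
Lemma measurable_lagrangian : measurable_fun setT L.
Proof.
apply: (measurability _ (RGenInftyO.measurableE R)) => _ [_ [a ->] <-].
rewrite setTI; apply: sub_sigma_algebra; rewrite /open_rV /= openE => x /=.
rewrite in_itv /= => Lxa.
have Lxa2 : 0 < (a - L x) / 2 by lra.
have [s s0 H] := lagrangian_usc x Lxa2.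
apply/nbhs_ballP; exists s => //= y [_ xy] /=; rewrite in_itv /=.
apply: (@le_lt_trans _ _ (L x + (a - L x) / 2)); last lra.
by apply: H => i; rewrite distrC; exact: xy.
Qed.
End lagrangian.

(** * Approximate gluing along a common foot law *)

Section gluing.
Context {R : realType} {d : nat}.
Local Notation V := 'rV[R]_d.

(** Balls of squared radius [e / 4] around a dense sequence cover the space; removing the earlier
    balls from each makes them disjoint. *)
Lemma small_cells (e : R) : 0 < e -> exists A : nat -> set V,
  [/\ forall n, measurable (A n), trivIset setT A, \bigcup_n A n = setT &
      forall n x y, A n x -> A n y -> sqnorm (x - y) <= e].
Proof.
move=> e0; have [q dq] := @rV_dense_seq R d.
pose F n := [set x : V | sqnorm (x - q n) < e / 4].
have mF n : measurable (F n).
  rewrite -[F n]setTI (_ : F n = (fun x => sqnorm (x - q n)) @^-1` `]-oo, e / 4[).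
    by apply: measurable_sqnorm => //; exact: measurable_rVB.
  by apply/seteqP; split=> x /=; rewrite in_itv.
exists (seqDU F); split.
- by move=> n; apply: measurableD => //; exact: bigsetU_measurable.
- exact: trivIset_seqDU.
- rewrite -seqDU_bigcup_eq -subTset => x _.
  have d0 : 0 <= d%:R :> R by [].
  (* Since [s <= 1], [d * s^2 <= d * s < s * (d + 1) <= e / 4]; the added 1 gives strictness and
     covers dimension 0. *)
  have [s s0 se] : exists2 s : R, 0 < s <= 1 & s * (d%:R + 1) <= e / 4.
    exists (Num.min 1 (e / 4 / (d%:R + 1))).
      by rewrite lt_min ltr01 ge_min lexx !divr_gt0 //; lra.
    by rewrite -ler_pdivlMr ?ge_min ?lexx ?orbT //; lra.
  have {s0}[s0 s1] := andP s0.
  have [n xn] := dq x s s0; exists n => //=.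
  apply: (@le_lt_trans _ _ (d%:R * s ^+ 2)); last first.
    have : s ^+ 2 <= s by rewrite expr2 ler_piMl // ltW.
    by move=> /(ler_wpM2l d0); lra.
  by apply: sqnorm_le_coord => i; rewrite !mxE distrC ltW.
- move=> n x y [Fx _] [Fy _]; rewrite /F /= in Fx Fy.
  rewrite (_ : x - y = (x - q n) + (-1) *: (y - q n)).
    by apply: le_trans (sqnormD_le _ _) _; rewrite sqnormZ sqrrN expr1n; lra.
  by rewrite scaleN1r opprB addrA subrK.
Qed.

Context {d1 d2 : measure_display} {Om1 : measurableType d1}
  {Om2 : measurableType d2}.
Variables (P : probability Om1 R) (Q : probability Om2 R).

(** Dividing by mass 1 changes nothing, so normalisation just bundles [m] as a probability; [P0] is
    the fallback that [mnormalize] asks for. *)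
Lemma probability_of_mass1 dO (Om : measurableType dO)
    (P0 : probability Om R) (m : {measure set Om -> \bar R}) :
  m setT = 1%E -> exists P' : probability Om R, forall A, P' A = m A.
Proof.
move=> m1; exists (mnormalize m P0) => A.
by rewrite /= /mnormalize m1 onee_eq0 /= invr1 mule1.
Qed.

(* No disintegration: on each cell [A n] the coupling is the normalized product
   of the restrictions of [P] and [Q]. *)
Lemma approx_gluing (f : Om1 -> V) (g : Om2 -> V) :
  measurable_fun setT f -> measurable_fun setT g ->
  (forall A, measurable A -> P (f @^-1` A) = Q (g @^-1` A)) ->
  forall e : R, 0 < e -> exists Th : probability (Om1 * Om2)%type R,
    [/\ same_measure (pushforward Th fst) P,
        same_measure (pushforward Th snd) Q &
        (\int[Th]_w (sqnorm (f w.1 - g w.2))%:E <= e%:E)%E].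
Proof.
move=> mf mg fg e e0; have [A [mA tA UA dA]] := small_cells e0.
pose C n := f @^-1` A n; pose D n := g @^-1` A n.
have mC n : measurable (C n) by rewrite -[C n]setTI; exact: mf.
have mD n : measurable (D n) by rewrite -[D n]setTI; exact: mg.
have mCD n : measurable (C n `*` D n) by exact: measurableX.
have tC : trivIset setT C.
  move=> i j _ _ [w [/= Ci Cj]]; apply: tA => //; by exists (f w).
have tD : trivIset setT D.
  move=> i j _ _ [w [/= Di Dj]]; apply: tA => //; by exists (g w).
have UC : \bigcup_n C n = setT by rewrite -preimage_bigcup UA preimage_setT.
have UD : \bigcup_n D n = setT by rewrite -preimage_bigcup UA preimage_setT.
(* [C n] and [D n] have the same mass, because [f] and [g] have the same law. *)
pose m n := fine (P (C n)).
have PC n : P (C n) = (m n)%:E by rewrite fineK // fin_num_measure.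
have QD n : Q (D n) = (m n)%:E by rewrite -PC fg.
have m0 n : 0 <= m n by rewrite -lee_fin -PC.
have minv0 n : 0 <= (m n)^-1 by rewrite invr_ge0.
pose k n : {measure set (Om1 * Om2) -> \bar R} :=
  mscale (NngNum (minv0 n)) (mrestr (P \x Q)%E (mCD n)).
pose M : {measure set (Om1 * Om2) -> \bar R} := mseries k 0.
have kE n S : k n S = ((m n)^-1%:E * (P \x Q) (S `&` (C n `*` D n)))%E by [].
have ME S : M S = (\sum_(n <oo) k n S)%E by [].
(* On a null cell the inverse is 0 by convention, but there [a <= m n] forces [a = 0]. *)
have ratio n (a : \bar R) : (0 <= a <= (m n)%:E -> (m n)^-1%:E * (a * (m n)%:E) = a)%E.
  case: a => [a| |] /andP[a0 am] //; rewrite lee_fin in a0; rewrite lee_fin in am.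
  rewrite -!EFinM mulrCA; congr (_%:E).
  have [mn0|mn0] := eqVneq (m n) 0; last by rewrite mulVf // mulr1.
  by rewrite mn0 mulr0 mulr0; lra.
(* On cell [n] the factor [Q (D n) = m n] cancels against the normalisation, and the pieces of [S]
   in the cells [C n] add up to [P S]. *)
have M1 S : measurable S -> M (fst @^-1` S) = P S.
  move=> mS; rewrite ME -[in RHS](setIT S) -UC setI_bigcupr.
  rewrite measure_semi_bigcup //.
  - apply: eq_eseriesr => n _; rewrite kE.
    rewrite (_ : _ `&` _ = (S `&` C n) `*` D n).
      rewrite product_measure1E; [|exact: measurableI|exact: mD].
      transitivity ((m n)^-1%:E * (P (S `&` C n) * (m n)%:E))%E.
        by congr (_ * (_ * _))%E; exact: QD.
      apply: ratio; rewrite measure_ge0 /= -PC.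
      by apply: le_measure; rewrite ?inE //; exact: measurableI.
    by apply/seteqP; split=> [[x y] [? []]|[x y] [[] ]].
  - by move=> n; exact: measurableI.
  - by move=> i j _ _ [w [[_ ?] [_ ?]]]; apply: tC => //; exists w.
  - by apply: bigcupT_measurable => n; exact: measurableI.
have M2 S : measurable S -> M (snd @^-1` S) = Q S.
  move=> mS; rewrite ME -[in RHS](setIT S) -UD setI_bigcupr.
  rewrite measure_semi_bigcup //.
  - apply: eq_eseriesr => n _; rewrite kE.
    rewrite (_ : _ `&` _ = C n `*` (S `&` D n)).
      rewrite product_measure1E; [|exact: mC|exact: measurableI].
      transitivity ((m n)^-1%:E * (Q (S `&` D n) * (m n)%:E))%E.
        by rewrite [in RHS](muleC (Q _)); congr (_ * (_ * _))%E; exact: PC.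
      apply: ratio; rewrite measure_ge0 /= -QD.
      by apply: le_measure; rewrite ?inE //; exact: measurableI.
    by apply/seteqP; split=> [[x y] [? []]|[x y] [? []]].
  - by move=> n; exact: measurableI.
  - by move=> i j _ _ [w [[_ ?] [_ ?]]]; apply: tD => //; exists w.
  - by apply: bigcupT_measurable => n; exact: measurableI.
have [|Th ThE] := @probability_of_mass1 _ _ (P \x Q)%E M.
  by have := M1 setT measurableT; rewrite preimage_setT probability_setT.
have mfg : measurable_fun setT (fun w : Om1 * Om2 => sqnorm (f w.1 - g w.2)).
  apply: measurable_sqnorm; apply: measurable_rVB.
  - exact: measurableT_comp mf measurable_fst.
  - exact: measurableT_comp mg measurable_snd.
exists Th; split.
- by move=> S mS; rewrite /pushforward ThE M1.
- by move=> S mS; rewrite /pushforward ThE M2.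
- have -> : e%:E = (\int[Th]_w (cst e%:E) w)%E.
    rewrite integral_cst // -[LHS]mule1; congr (_ * _)%E.
    exact/esym/probability_setT.
  apply: ae_ge0_le_integral => //.
  + by move=> w _; rewrite lee_fin sqnorm_ge0.
  + exact/measurable_EFinP.
  + by move=> w _; rewrite lee_fin ltW.
  (* [Th] is carried by the products [C n] x [D n], and points of one cell are [e]-close: the
     exceptional set [N] misses every product and is null. *)
  pose N := [set w : Om1 * Om2 | e < sqnorm (f w.1 - g w.2)].
  have mN : measurable N.
    rewrite -[N]setTI (_ : N = (fun w => sqnorm (f w.1 - g w.2)) @^-1` `]e, +oo[).
      exact: mfg.
    by apply/seteqP; split=> x /=; rewrite in_itv /= andbT.
  exists N; split=> //.
  + transitivity (M N); first exact: ThE.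
    rewrite ME eseries0 // => n _ _; rewrite kE.
    rewrite (_ : N `&` _ = set0) ?measure0 ?mule0 //.
    rewrite -subset0 => -[x y] [Nxy [/= Cx Dy]].
    have := lt_le_trans Nxy (dA n _ _ Cx Dy); by rewrite ltxx.
  + by move=> w /= H; rewrite /N /= ltNge; apply/negP => h; apply: H => _; rewrite lee_fin.
Qed.

End gluing.

(** * The Legendre transform and the integral of the Hamiltonian *)

(** The properties of [L] in the form used by the estimates, with [sqnorm] for the squared norm and
    the constants as parameters. *)
Record coercive_lagrangian {R : realType} {d : nat} (L : 'rV[R]_d -> R)
    (B c C : R) : Prop := CoerciveLagrangian {
  lagrangian_conv : forall (t : R) (x y : 'rV[R]_d), 0 <= t <= 1 ->
    L (t *: x + (1 - t) *: y) <= t * L x + (1 - t) * L y;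
  lagrangian_quad : forall z, `|L z| <= B * (1 + sqnorm z);
  lagrangian0 : L 0 = 0;
  lagrangian_coer_pos : 0 < c;
  lagrangian_coer : forall z, c * sqnorm z - C <= L z }.

Section hamiltonian.
Context {R : realType} {d : nat}.
Local Notation V := 'rV[R]_d.
Variables (L : V -> R) (B c C : R).
Hypothesis hL : coercive_lagrangian L B c C.

Local Notation H := (hamiltonian L).

(** The expression whose supremum over [v] is [hamiltonian L p]. *)
Definition legendre (v p : V) : R := - dotv v p - L v.

Lemma coercive_lagrangian_measurable : measurable_fun setT L.
Proof. exact: measurable_lagrangian (lagrangian_conv hL) _ (lagrangian_quad hL). Qed.

Let mL := coercive_lagrangian_measurable.

(** Young's inequality with weight [c] makes the term [c |v|^2] cancel against the coercivity of
    [L]; hence the supremum over [v] is finite. *)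
Lemma legendre_le v p : legendre v p <= (4 * c)^-1 * sqnorm p + C.
Proof.
have := dotv_young v p (lagrangian_coer_pos hL); rewrite ler_norml => /andP[+ _].
by have := lagrangian_coer hL v; rewrite /legendre; lra.
Qed.

(** The zero velocity makes the Hamiltonian nonnegative, and it starts the selection below at the
    value 0, as monotone convergence requires. *)
Lemma legendre0 p : legendre 0 p = 0.
Proof. by rewrite /legendre dotvC dotv0 (lagrangian0 hL) oppr0 addr0. Qed.

Lemma hamiltonian_has_sup p :
  has_sup [set dotv (- v) p - L v | v in [set: V]].
Proof.
split; first by exists (dotv (- 0) p - L 0), 0.
exists ((4 * c)^-1 * sqnorm p + C) => _ [v _ <-].
by rewrite dotvNl; exact: legendre_le.
Qed.

Lemma fenchel_young v p : legendre v p <= H p.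
Proof.
rewrite /legendre -dotvNl; apply: ub_le_sup; last by exists v.
by have [] := hamiltonian_has_sup p.
Qed.

Lemma hamiltonian_ge0 p : 0 <= H p.
Proof. by rewrite -(legendre0 p) fenchel_young. Qed.

Lemma hamiltonian_le p : H p <= (4 * c)^-1 * sqnorm p + C.
Proof.
have [n0 _] := hamiltonian_has_sup p.
by apply: ge_sup => // _ [v _ <-]; rewrite dotvNl; exact: legendre_le.
Qed.

Section selection.
Variable q : nat -> V.
Hypothesis q_dense : forall (x : V) (s : R), 0 < s ->
  exists n, forall i, `|q n ord0 i - x ord0 i| < s.

(** A maximizer of [legendre ^~ p] among 0 and the first [n] points of [q]; the recursion lets
    measurability in [p] follow by induction. *)
Fixpoint legendre_sel n (p : V) : V :=
  if n is n'.+1 then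
    if legendre (legendre_sel n' p) p < legendre (q n') p then q n'
    else legendre_sel n' p
  else 0.

Definition legendre_max n p := legendre (legendre_sel n p) p.

Lemma legendre_maxS n p :
  legendre_max n.+1 p = Num.max (legendre_max n p) (legendre (q n) p).
Proof. by rewrite /legendre_max /= maxEge; case: ltP. Qed.

Lemma measurable_legendre_sel n : measurable_fun setT (legendre_sel n).
Proof.
elim: n => [|n IH] /=; first exact: measurable_cst.
apply: measurable_fun_ifT => //; apply: measurable_fun_ltr.
- apply: measurable_funB; last exact: measurableT_comp.
  by apply: measurableT_comp => //; exact: measurable_dotv.
- apply: measurable_funB => //.
  by apply: measurableT_comp => //; apply: measurable_dotv.
Qed.

Lemma measurable_legendre_max n : measurable_fun setT (legendre_max n).
Proof.
have ? := measurable_legendre_sel n.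
apply: measurable_funB; last exact: measurableT_comp.
by apply: measurableT_comp => //; exact: measurable_dotv.
Qed.

Lemma legendre_sel_bounded n : exists M, forall p, sqnorm (legendre_sel n p) <= M.
Proof.
elim: n => [|n [M IH]] /=; first by exists 0 => p; rewrite sqnorm0.
exists (Num.max M (sqnorm (q n))) => p.
by case: ifP => _; rewrite le_max ?IH ?lexx ?orbT.
Qed.

Lemma legendre_max_nd p : {homo legendre_max ^~ p : m n / (m <= n)%N >-> m <= n}.
Proof. by apply/nondecreasing_seqP => n; rewrite legendre_maxS le_max lexx. Qed.

Lemma legendre_max_ge0 n p : 0 <= legendre_max n p.
Proof. by rewrite -(legendre0 p); exact: (legendre_max_nd p (leq0n n)). Qed.

(** Take [v] optimal up to [e / 2]. The function [L' = L + <., p>] is again convex with quadratic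
    growth, so upper semicontinuity at [v] loses at most [e / 2] when [v] is replaced by a nearby
    [q n]. *)
Lemma legendre_max_near p (e : R) : 0 < e ->
  exists n, H p - e <= legendre_max n p.
Proof.
move=> e0; have e2 : 0 < e / 2 by lra.
have [_ [v _ <-]] := sup_adherent e2 (hamiltonian_has_sup p).
rewrite -/(hamiltonian L p) dotvNl => vp.
pose L' w := L w + dotv w p.
have L'conv (t : R) (x y : V) : 0 <= t <= 1 ->
    L' (t *: x + (1 - t) *: y) <= t * L' x + (1 - t) * L' y.
  move=> t01; have := lagrangian_conv hL x y t01.
  by rewrite /L' dotvDl !dotvZl; lra.
have L'quad z : `|L' z| <= (B + 1 + sqnorm p) * (1 + sqnorm z).
  have := ler_normD (L z) (dotv z p).
  have := lagrangian_quad hL z; have := dotv_le z p.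
  have := mulr_ge0 (sqnorm_ge0 p) (sqnorm_ge0 z).
  rewrite /L'; lra.
have [s s0 Hs] := lagrangian_usc L'conv L'quad v e2.
have [n qn] := q_dense v s0.
(* [q n] becomes a candidate at stage [n.+1]. *)
exists n.+1; rewrite legendre_maxS le_max; apply/orP; right.
by have := Hs _ qn; rewrite /L' /legendre; lra.
Qed.

Lemma legendre_max_cvg p : legendre_max n p @[n --> \oo] --> H p.
Proof.
apply/cvgrPdist_le => e e0; have [N HN] := legendre_max_near p e0.
exists N => //= n /= Nn.
rewrite ger0_norm ?subr_ge0 ?fenchel_young //.
by have := legendre_max_nd p Nn; rewrite /= -/(legendre_max _ _); lra.
Qed.

End selection.

(** A limit of maxima over finitely many velocities replaces the uncountable supremum. *)
Lemma measurable_hamiltonian : measurable_fun setT H.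
Proof.
have [q dq] := @rV_dense_seq R d.
apply: (@measurable_fun_cvg _ _ _ _ (fun n p => legendre_max q n p)).
- by move=> n; exact: measurable_legendre_max.
- by move=> p _; exact: legendre_max_cvg.
Qed.

Section integrals.
Context {dO : measure_display} {Om : measurableType dO}.
Variable P : probability Om R.
Implicit Types X Y : Om -> V.

Lemma integrable_lagrangian X : measurable_fun setT X -> sqint P X ->
  P.-integrable setT (EFin \o (fun w => L (X w))).
Proof.
move=> mX iX.
apply: (@integrable_domR _ _ _ P _ (fun w => B + B * sqnorm (X w))).
- exact: (measurableT_comp mL mX).
- by apply: integrableDR; [exact: integrable_cstR|exact: integrableZR].
- by move=> w; rewrite -[X in X + _]mulr1 -mulrDr (lagrangian_quad hL).
Qed.

Lemma integrable_hamiltonian X : measurable_fun setT X -> sqint P X ->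
  P.-integrable setT (EFin \o (fun w => H (X w))).
Proof.
move=> mX iX.
apply: (@integrable_domR _ _ _ P _ (fun w => (4 * c)^-1 * sqnorm (X w) + C)).
- exact: (measurableT_comp measurable_hamiltonian mX).
- by apply: integrableDR; [exact: integrableZR|exact: integrable_cstR].
- by move=> w; rewrite ger0_norm ?hamiltonian_ge0 // hamiltonian_le.
Qed.

Lemma integrable_legendre X Y : measurable_fun setT X -> measurable_fun setT Y ->
  sqint P X -> sqint P Y ->
  P.-integrable setT (EFin \o (fun w => legendre (X w) (Y w))).
Proof.
move=> mX mY iX iY; apply: integrableDR; apply: integrableNR.
- exact: integrable_dotv.
- exact: integrable_lagrangian.
Qed.

Lemma sqint_bounded X (M : R) : measurable_fun setT X ->
  (forall w, sqnorm (X w) <= M) -> sqint P X.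
Proof.
move=> mX XM; apply: (integrable_domR _ (integrable_cstR P M)).
- exact: measurable_sqnorm.
- by move=> w; rewrite ger0_norm ?sqnorm_ge0.
Qed.

(* Bounded feedback velocities compute the relaxed Hamiltonian: this replaces
   a measurable selection of maximizers. *)
Lemma Rintegral_hamiltonian_le Y (r : R) : measurable_fun setT Y -> sqint P Y ->
  (forall v : V -> V, measurable_fun setT v ->
     sqint P (fun w => v (Y w)) -> \int[P]_w legendre (v (Y w)) (Y w) <= r) ->
  \int[P]_w H (Y w) <= r.
Proof.
move=> mY iY Hr; have [q dq] := @rV_dense_seq R d.
pose g n w := (legendre_max q n (Y w))%:E.
have mg n : measurable_fun setT (g n).
  apply/measurable_EFinP.
  exact: (measurableT_comp (measurable_legendre_max q n) mY).
have g0 n w : [set: Om] w -> (0 <= g n w)%E by rewrite lee_fin legendre_max_ge0.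
have ndg w : [set: Om] w -> {homo g ^~ w : m n / (m <= n)%N >-> (m <= n)%E}.
  by move=> _ m n mn; rewrite lee_fin; exact: legendre_max_nd.
have limg w : limn (g ^~ w) = (H (Y w))%:E.
  apply/cvg_lim => //; apply: cvg_EFin; first by apply: nearW.
  exact: legendre_max_cvg.
have E : (\int[P]_w limn (g ^~ w) = \int[P]_w (H (Y w))%:E)%E.
  by apply: eq_integral => w _; exact: limg.
(* Monotone convergence reduces the bound to each [n], where the hypothesis applies to the bounded
   velocity [legendre_sel q n]. *)
have := cvg_monotone_convergence (mu := P) measurableT mg g0 ndg.
rewrite E => /cvge_to_le cvgH; rewrite -lee_fin fineK; last first.
  exact: integrable_fin_num (integrable_hamiltonian mY iY).
apply: cvgH; apply: nearW => n.
have [M HM] := legendre_sel_bounded q n.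
have ms := measurable_legendre_sel q n.
have isel : sqint P (fun w => legendre_sel q n (Y w)).
  apply: (@sqint_bounded _ M) => //.
  exact: (measurableT_comp ms mY).
have := Hr _ ms isel; rewrite -lee_fin fineK //.
apply: integrable_fin_num => //; apply: integrable_legendre => //.
exact: (measurableT_comp ms mY).
Qed.

End integrals.
End hamiltonian.

(** * Plans as joint laws of random variables *)

Section law_closure.
Context {R : realType} {d1 d2 d3 : measure_display} {Om : measurableType d1}
  {S : measurableType d2} {S' : measurableType d3}.

Lemma law_comp (P : probability Om R) (m : probability S R) (X : Om -> S)
    (h : S -> S') : measurable_fun setT h ->
  same_measure (pushforward P X) m ->
  same_measure (pushforward P (h \o X)) (pushforward m h).
Proof.
move=> mh Xm A mA; rewrite /pushforward comp_preimage; apply: Xm.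
by rewrite -[X in measurable X]setTI; exact: mh.
Qed.

End law_closure.

Section plans.
Context {R : realType} {d : nat}.
Local Notation V := 'rV[R]_d.
Context {dO : measure_display} {Om : measurableType dO}.
Variable P : probability Om R.
Implicit Types (X Y Z : Om -> V) (mu nu : probability V R).

Lemma sqint_law dS (S : measurableType dS) (m : probability S R) (f : Om -> S)
    (X : S -> V) : measurable_fun setT f -> same_measure (pushforward P f) m ->
  measurable_fun setT X -> sqint m X -> sqint P (X \o f).
Proof.
move=> mf fm mX.
exact: (law_integrable mf fm (F := fun x => sqnorm (X x)) (measurable_sqnorm mX)).1.
Qed.

Lemma law_P2 X mu : measurable_fun setT X -> sqint P X ->
  same_measure (pushforward P X) mu -> P2 mu.
Proof.
move=> mX iX Xmu; rewrite /P2 /= (law_ge0_integral mX Xmu).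
- exact/sqint_lty.
- by apply/measurable_EFinP; apply: (@measurable_sqnorm _ _ _ _ id).
- by move=> x; rewrite lee_fin sqnorm_ge0.
Qed.

Lemma measurable_sqnorm12 : measurable_fun setT
  (fun w : V * V => sqnorm w.1 + sqnorm w.2).
Proof.
apply: measurable_funD; apply: measurable_sqnorm.
- exact: measurable_fst.
- exact: measurable_snd.
Qed.

Lemma law_P2mu X Z mu (gamma : probability (V * V)%type R) :
  measurable_fun setT X -> measurable_fun setT Z -> sqint P X -> sqint P Z ->
  same_measure (pushforward P X) mu ->
  same_measure (pushforward P (fun w => (X w, Z w))) gamma -> P2mu mu gamma.
Proof.
move=> mX mZ iX iZ Xmu XZ; have mXZ := measurable_fun_pair mX mZ; split.
- rewrite /P2x2 /= (law_ge0_integral mXZ XZ) /=.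
  + by have := integrable_lty measurableT (integrableDR iX iZ).
  + by apply/measurable_EFinP; exact: measurable_sqnorm12.
  + by move=> x; rewrite lee_fin addr_ge0 ?sqnorm_ge0.
- by move=> A mA; rewrite -(law_comp measurable_fst XZ mA) -Xmu.
Qed.

End plans.

Section plan_projections.
Context {R : realType} {d : nat}.
Local Notation V := 'rV[R]_d.
Variables (mu : probability V R) (gamma : probability (V * V)%type R).
Hypothesis hg : P2mu mu gamma.

Let igamma : gamma.-integrable setT
  (EFin \o (fun w : V * V => sqnorm w.1 + sqnorm w.2)).
Proof.
apply: ge0_integrable_lty hg.1; first exact: measurable_sqnorm12.
by move=> w; rewrite addr_ge0 ?sqnorm_ge0.
Qed.

Lemma P2mu_sqint1 : sqint gamma fst.
Proof.
apply: integrable_domR igamma _ => [|w].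
- by apply: measurable_sqnorm; exact: measurable_fst.
- by rewrite ger0_norm ?sqnorm_ge0 // lerDl sqnorm_ge0.
Qed.

Lemma P2mu_sqint2 : sqint gamma snd.
Proof.
apply: integrable_domR igamma _ => [|w].
- by apply: measurable_sqnorm; exact: measurable_snd.
- by rewrite ger0_norm ?sqnorm_ge0 // lerDr sqnorm_ge0.
Qed.

End plan_projections.

(** * Wasserstein distance bounded through joint laws *)

Section wasserstein_lipschitz.
Context {R : realType} {d : nat}.
Local Notation V := 'rV[R]_d.

Lemma W2_ge0 (mu nu : probability V R) : (0 <= W2 mu nu)%E.
Proof. exact: sqrte_ge0. Qed.

(** The law of [(X, Y)] is an admissible coupling of [mu] and [nu]. *)
Lemma W2_le_law dO (Om : measurableType dO) (P : probability Om R)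
    (X Y : Om -> V) (mu nu : probability V R) (e : R) :
  measurable_fun setT X -> measurable_fun setT Y ->
  same_measure (pushforward P X) mu -> same_measure (pushforward P Y) nu ->
  0 <= e -> (\int[P]_w (sqnorm (X w - Y w))%:E <= (e ^+ 2)%:E)%E ->
  (W2 mu nu <= e%:E)%E.
Proof.
move=> mX mY Xmu Ynu e0 XY; have mXY := measurable_fun_pair mX mY.
have [s XYs] := law_exists P mXY.
have scost : transport_cost s = (\int[P]_w (sqnorm (X w - Y w))%:E)%E.
  rewrite /transport_cost (law_ge0_integral mXY XYs) //.
  - apply/measurable_EFinP; apply: measurable_sqnorm; apply: measurable_rVB.
    + exact: measurable_fst.
    + exact: measurable_snd.
  - by move=> w; rewrite lee_fin sqnorm_ge0.
rewrite /W2 -[e]ger0_norm // -sqrtr_sqr.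
apply: (@le_trans _ _ (sqrte (e ^+ 2)%:E)); last by [].
rewrite lee_sqrt ?lee_fin ?sqr_ge0 //; apply: le_trans XY; rewrite -scost.
apply: ereal_inf_lbound; exists s => //; split=> A mA.
- by rewrite -(law_comp measurable_fst XYs mA) -Xmu.
- by rewrite -(law_comp measurable_snd XYs mA) -Ynu.
Qed.

End wasserstein_lipschitz.

(** * The Hopf-Lax value and dynamic programming *)

Section hopf_lax_value.
Context {R : realType} {d : nat}.
Local Notation V := 'rV[R]_d.
Variables (L : V -> R) (B c C : R) (G : probability V R -> R) (K m T : R).
Hypothesis hL : coercive_lagrangian L B c C.
Hypothesis K0 : 0 <= K.
Hypothesis GK : forall mu nu : probability V R, P2 mu -> P2 nu ->
  (`|G mu - G nu|%:E <= K%:E * W2 mu nu)%E.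
Hypothesis Gm : forall mu : probability V R, P2 mu -> m <= G mu.

Local Notation val := (hopf_lax T G L).

Let mL := coercive_lagrangian_measurable hL.

Lemma G_law_lipschitz dO (Om : measurableType dO) (P : probability Om R)
    (X Y : Om -> V) (mu nu : probability V R) (e : R) :
  measurable_fun setT X -> measurable_fun setT Y -> sqint P X -> sqint P Y ->
  same_measure (pushforward P X) mu -> same_measure (pushforward P Y) nu ->
  0 <= e -> (\int[P]_w (sqnorm (X w - Y w))%:E <= (e ^+ 2)%:E)%E ->
  `|G mu - G nu| <= K * e.
Proof.
move=> mX mY iX iY Xmu Ynu e0 XY; rewrite -lee_fin EFinM.
apply: le_trans (GK (law_P2 mX iX Xmu) (law_P2 mY iY Ynu)) _.
by rewrite lee_wpmul2l ?lee_fin //; exact: W2_le_law XY.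
Qed.

(** Probabilities that agree on measurable sets need not be equal as terms, but their distance is 0
    and [G] is Lipschitz. *)
Lemma G_law dO (Om : measurableType dO) (P : probability Om R)
    (X : Om -> V) (mu nu : probability V R) :
  measurable_fun setT X -> sqint P X ->
  same_measure (pushforward P X) mu -> same_measure (pushforward P X) nu ->
  G mu = G nu.
Proof.
move=> mX iX Xmu Xnu; apply/eqP; rewrite -subr_eq0 -normr_le0 -(mulr0 K).
apply: (G_law_lipschitz mX mX iX iX Xmu Xnu) => //.
by under eq_integral do rewrite subrr sqnorm0; rewrite integral0 expr0n.
Qed.

Lemma Rintegral_lagrangian_ge dO (Om : measurableType dO)
    (P : probability Om R) (X : Om -> V) :
  measurable_fun setT X -> sqint P X ->
  c * (\int[P]_w sqnorm (X w)) - C <= \int[P]_w L (X w).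
Proof.
move=> mX iX; rewrite -RintegralZl // -[X in _ - X](Rintegral_cstT P).
rewrite -RintegralB //; last 2 first.
- exact: integrableZR.
- exact: integrable_cstR.
apply: le_Rintegral => //.
- apply: integrableDR; first exact: integrableZR.
  exact: (integrable_cstR P (- C)).
- exact: (integrable_lagrangian hL).
- by move=> w _; exact: (lagrangian_coer hL).
Qed.

Lemma Rintegral_sqnorm_ge0 dO (Om : measurableType dO)
    (P : probability Om R) (X : Om -> V) : 0 <= \int[P]_w sqnorm (X w).
Proof. by apply: Rintegral_ge0 => w _; exact: sqnorm_ge0. Qed.

Lemma relaxed_scale_plan (gamma : probability (V * V)%type R) (a : R) :
  relaxed L (scale_plan a gamma) = \int[gamma]_w L (a *: w.2).
Proof.
rewrite /relaxed (@law_Rintegral _ _ _ _ _ gamma (scale2 a)) //.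
exact: measurableT_comp mL measurable_snd.
Qed.

Definition hopf_lax_cost t (gamma : probability (V * V)%type R) : R :=
  G (expmu gamma) + (T - t) * relaxed L (scale_plan (T - t)^-1 gamma).

Lemma hopf_laxE t mu : t < T ->
  val t mu = inf [set hopf_lax_cost t gamma | gamma in P2mu mu].
Proof. by move=> tT; rewrite /hopf_lax tT. Qed.

Lemma expmu_P2 (mu : probability V R) (gamma : probability (V * V)%type R) :
  P2mu mu gamma -> P2 (expmu gamma).
Proof.
move=> hg; apply: (@law_P2 _ _ _ _ gamma Defs.addv (expmu gamma)) => //.
apply: sqintD (P2mu_sqint1 hg) (P2mu_sqint2 hg).
- exact: measurable_fst.
- exact: measurable_snd.
Qed.

(** [G >= m], and coercivity gives [L >= - C]; a lower bound is what makes the real [inf]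
    meaningful. *)
Lemma hopf_lax_cost_ge (mu : probability V R) t
    (gamma : probability (V * V)%type R) : t < T -> P2mu mu gamma ->
  m - (T - t) * C <= hopf_lax_cost t gamma.
Proof.
move=> tT hg; apply: lerD; first exact: Gm (expmu_P2 hg).
rewrite -mulrN ler_pM2l ?subr_gt0 // relaxed_scale_plan.
have mZ : measurable_fun setT (fun w : V * V => (T - t)^-1 *: w.2).
  by apply: measurable_rVZ; exact: measurable_snd.
have iZ := sqintZ (T - t)^-1 (P2mu_sqint2 hg).
apply: le_trans (Rintegral_lagrangian_ge mZ iZ).
have := Rintegral_sqnorm_ge0 gamma (fun w : V * V => (T - t)^-1 *: w.2).
by move=> /(mulr_ge0 (ltW (lagrangian_coer_pos hL))); lra.
Qed.

Lemma hopf_lax_has_lbound t (mu : probability V R) : t < T ->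
  has_lbound [set hopf_lax_cost t gamma | gamma in P2mu mu].
Proof.
move=> tT; exists (m - (T - t) * C) => _ [gamma hg <-].
exact: hopf_lax_cost_ge hg.
Qed.

(** The competitor is the law of [(X, (T - t) W)], whose rescaling in the cost gives back the
    velocity [W]. *)
Lemma hopf_lax_le dO (Om : measurableType dO) (P : probability Om R)
    (X W : Om -> V) t (mu nu : probability V R) : t < T ->
  measurable_fun setT X -> measurable_fun setT W -> sqint P X -> sqint P W ->
  same_measure (pushforward P X) mu ->
  same_measure (pushforward P (fun w => X w + (T - t) *: W w)) nu ->
  val t mu <= G nu + (T - t) * \int[P]_w L (W w).
Proof.
move=> tT mX mW iX iW Xmu XWnu.
have mZ := measurable_rVZ (T - t) mW; have iZ := sqintZ (T - t) iW.
have mXZ := measurable_fun_pair mX mZ.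
have [gamma hgamma] := law_exists P mXZ.
have hg := law_P2mu mX mZ iX iZ Xmu hgamma.
rewrite hopf_laxE //; apply: ge_inf; first exact: hopf_lax_has_lbound.
exists gamma => //; congr (_ + _ * _).
- apply: (@G_law _ _ P _ _ _ (measurable_rVD mX mZ)) XWnu.
    exact: sqintD.
  by move=> A mA; exact: (law_comp measurable_addv hgamma mA).
- rewrite relaxed_scale_plan (law_Rintegral mXZ hgamma) /=; last first.
    apply: measurableT_comp mL _; apply: measurable_rVZ; exact: measurable_snd.
  by apply: eq_Rintegral => w _; rewrite scalerA mulVf ?scale1r ?gt_eqF ?subr_gt0.
Qed.

(** A nearly optimal plan carries displacements over the time [T - t]; [xi] is its rescaling to
    velocities. *)
Lemma hopf_lax_near (e : R) t (mu : probability V R) : t < T -> P2 mu -> 0 < e ->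
  exists (xi : probability (V * V)%type R) (nu : probability V R),
  [/\ P2mu mu xi,
      same_measure (pushforward xi (fun w => w.1 + (T - t) *: w.2)) nu &
      G nu + (T - t) * (\int[xi]_w L w.2) < val t mu + e].
Proof.
move=> tT hmu e0.
have mid : measurable_fun [set: V] (fun x : V => x) by exact: measurable_id.
have m0 : measurable_fun [set: V] (fun _ : V => (0 : V)) by exact: measurable_cst.
have imu : sqint mu (fun x => x) by exact/sqint_lty.
have hinf : has_inf [set hopf_lax_cost t gamma | gamma in P2mu mu].
  split; last exact: hopf_lax_has_lbound.
  (* The plan with zero displacement shows that competitors exist. *)
  have [gamma hgamma] := law_exists mu (measurable_fun_pair mid m0).
  exists (hopf_lax_cost t gamma), gamma => //.
  apply: (law_P2mu mid m0 imu _ _ hgamma) => //.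
  by apply: (@sqint_bounded _ _ _ _ _ _ 0) => // w; rewrite sqnorm0.
have [_ [gamma hg <-] near] := inf_adherent e0 hinf.
have mg1 : measurable_fun setT (fst : V * V -> V) by exact: measurable_fst.
have mg2 : measurable_fun setT (fun w : V * V => (T - t)^-1 *: w.2).
  by apply: measurable_rVZ; exact: measurable_snd.
have ig2 := sqintZ (T - t)^-1 (P2mu_sqint2 hg).
exists (scale_plan (T - t)^-1 gamma), (expmu gamma); split.
- by apply: (law_P2mu mg1 mg2 (P2mu_sqint1 hg) ig2 hg.2).
- move=> A mA; rewrite /pushforward /scale_plan /expmu /distribution /pushforward.
  congr (gamma _); apply/seteqP; rewrite /preimage /scale2 /Defs.addv.
  by split=> w /=; rewrite scalerA mulfV ?scale1r ?gt_eqF ?subr_gt0.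
- by move: near; rewrite -hopf_laxE.
Qed.

(** Running at [W] for time [h] and then at a nearly optimal [v] is replaced by running at the
    average velocity [Z = s W + (1 - s) v]. By convexity this costs no more, and the endpoint moves
    only by the gluing error. *)
Lemma dynamic_programming dO (Om : measurableType dO) (P : probability Om R)
    (X W : Om -> V) t h (mu nu : probability V R) : 0 < h -> t + h < T ->
  measurable_fun setT X -> measurable_fun setT W -> sqint P X -> sqint P W ->
  same_measure (pushforward P X) mu ->
  same_measure (pushforward P (fun w => X w + h *: W w)) nu ->
  val t mu <= h * (\int[P]_w L (W w)) + val (t + h) nu.
Proof.
move=> h0 thT mX mW iX iW Xmu XWnu; apply/ler_addgt0Pr => e e0.
have e2 : 0 < e / 2 by lra.
have tT : t < T by lra.
have mXW := measurable_rVD mX (measurable_rVZ h mW).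
have iXW := sqintD mX (measurable_rVZ h mW) iX (sqintZ h iW).
have [xi [nu' [hxi xinu' near]]] :=
  hopf_lax_near thT (law_P2 mXW iXW XWnu) e2.
have mx1 : measurable_fun setT (fst : V * V -> V) by exact: measurable_fst.
have mx2 : measurable_fun setT (snd : V * V -> V) by exact: measurable_snd.
(* The gluing error costs [K * k <= e / 2]; the added 1 covers [K = 0]. *)
pose k := e / 2 / (K + 1).
have K1 : 0 < K + 1 by rewrite ltr_wpDl.
have k0 : 0 < k by rewrite !divr_gt0.
have Kk : K * k <= e / 2.
  by rewrite /k mulrCA ler_piMr ?(ltW e2) // ler_pdivrMr // mul1r lerDl.
have same_foot A : measurable A ->
    P ((fun w => X w + h *: W w) @^-1` A) = xi (fst @^-1` A).
  by move=> mA; rewrite [LHS](XWnu A mA) -(hxi.2 A mA).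
have k2 : 0 < k ^+ 2 by rewrite exprn_gt0.
have [Th [Th1 Th2 Thk]] := approx_gluing mXW mx1 same_foot k2.
have mT1 : measurable_fun setT (fst : Om * (V * V) -> Om) by exact: measurable_fst.
have mT2 : measurable_fun setT (snd : Om * (V * V) -> V * V) by exact: measurable_snd.
have mX' := measurableT_comp mX mT1.
have mW' := measurableT_comp mW mT1.
have my := measurableT_comp mx1 mT2.
have mv := measurableT_comp mx2 mT2.
have iX' : sqint Th (X \o fst) by exact: sqint_law mT1 Th1 mX iX.
have iW' : sqint Th (W \o fst) by exact: sqint_law mT1 Th1 mW iW.
have iy : sqint Th (fst \o snd) by exact: sqint_law mT2 Th2 mx1 (P2mu_sqint1 hxi).
have iv : sqint Th (snd \o snd) by exact: sqint_law mT2 Th2 mx2 (P2mu_sqint2 hxi).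
pose tau := T - t.
have tau0 : 0 < tau by rewrite subr_gt0.
pose s := h / tau.
have s0 : 0 < s by rewrite divr_gt0.
have s1 : s < 1 by rewrite ltr_pdivrMr // mul1r ltrBrDl.
have stau : tau * s = h by rewrite mulrC divfK // gt_eqF.
clearbody s.
pose Z (w : Om * (V * V)) := s *: W w.1 + (1 - s) *: w.2.2.
have tauZ w : tau *: Z w = h *: W w.1 + (tau - h) *: w.2.2.
  by rewrite /Z scalerDr !scalerA mulrBr mulr1 stau.
have mZ : measurable_fun setT Z.
  by apply: measurable_rVD; apply: measurable_rVZ.
have iZ : sqint Th Z.
  by apply: sqintD; [exact: measurable_rVZ|exact: measurable_rVZ|exact: sqintZ|exact: sqintZ].
have mXZ := measurable_rVD mX' (measurable_rVZ tau mZ).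
have iXZ := sqintD mX' (measurable_rVZ tau mZ) iX' (sqintZ tau iZ).
have [nu'' hnu''] := law_exists Th mXZ.
have Th1mu : same_measure (pushforward Th (X \o fst)) mu.
  by move=> A mA; rewrite (law_comp mX Th1 mA) -Xmu.
apply: le_trans (hopf_lax_le tT mX' mZ iX' iZ Th1mu hnu'') _.
(* Both endpoints contain the displacement [(tau - h) v], so their difference is that of the
   feet. *)
have GG : `|G nu'' - G nu'| <= K * k.
  have my' := measurable_rVD my (measurable_rVZ (tau - h) mv).
  apply: (G_law_lipschitz mXZ my' iXZ _ hnu'' _ (ltW k0)).
  - by apply: sqintD => //; [exact: measurable_rVZ|exact: sqintZ].
  - move=> A mA; rewrite -(xinu' A mA).
    have mh : measurable_fun setT (fun w : V * V => w.1 + (T - (t + h)) *: w.2).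
      exact: measurable_rVD mx1 (measurable_rVZ _ mx2).
    rewrite -(law_comp mh Th2 mA) /tau opprD addrA.
    by congr (pushforward _ _ _).
  - apply: le_trans Thk; rewrite le_eqVlt; apply/orP; left; apply/eqP.
    apply: eq_integral => w _; congr (sqnorm _)%:E.
    by rewrite tauZ /= addrA opprD addrA addrAC addrK.
have LZ : \int[Th]_w L (Z w) <=
    s * (\int[P]_w L (W w)) + (1 - s) * (\int[xi]_w L w.2).
  rewrite (law_Rintegral mT1 Th1 (F := fun w => L (W w))); last first.
    exact: measurableT_comp.
  rewrite (law_Rintegral mT2 Th2 (F := fun w => L w.2)); last first.
    exact: measurableT_comp.
  have iLW := integrable_lagrangian hL mW' iW'.
  have iLv := integrable_lagrangian hL mv iv.
  rewrite -!RintegralZl // -RintegralD //; try exact: integrableZR.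
  apply: le_Rintegral => //.
  - exact: (integrable_lagrangian hL).
  - by apply: integrableDR; exact: integrableZR.
  - by move=> w _; apply: (lagrangian_conv hL); rewrite !ltW.
have := LZ; rewrite -(ler_pM2l tau0) mulrDr !mulrA mulrBr mulr1 stau => tLZ.
have : T - (t + h) = tau - h by rewrite opprD addrA.
move: near GG; rewrite ler_norml => near /andP[_ GG] tauh; rewrite tauh in near.
by rewrite -/tau; clear -hL K0 GK Gm mL T tLZ tauh near GG Kk; lra.
Qed.


End hopf_lax_value.

(** * The two viscosity inequalities *)

Section viscosity.
Context {R : realType} {d : nat}.
Local Notation V := 'rV[R]_d.
Variables (L : V -> R) (B c C : R) (G : probability V R -> R) (K m T : R).
Hypothesis hL : coercive_lagrangian L B c C.
Hypothesis K0 : 0 <= K.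
Hypothesis GK : forall mu nu : probability V R, P2 mu -> P2 nu ->
  (`|G mu - G nu|%:E <= K%:E * W2 mu nu)%E.
Hypothesis Gm : forall mu : probability V R, P2 mu -> m <= G mu.

Local Notation val := (hopf_lax T G L).

Let mL := coercive_lagrangian_measurable hL.

Section test_plan.
Context {dO : measure_display} {Om : measurableType dO}.
Variables (P : probability Om R) (X Y W : Om -> V).
Hypotheses (mX : measurable_fun setT X) (mY : measurable_fun setT Y)
  (mW : measurable_fun setT W).
Hypotheses (iX : sqint P X) (iY : sqint P Y) (iW : sqint P W).
Variables (mu : probability V R) (gamma : probability (V * V)%type R).
Hypothesis Xmu : same_measure (pushforward P X) mu.
Hypothesis XYgamma : same_measure (pushforward P (fun w => (X w, Y w))) gamma.

(** [xi] is the law of [(X, h W)] and [theta] that of [(X, Y, h W)], so the norm and the pairing are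
    both linear in [h]. *)
Lemma test_plan (h : R) : 0 < h ->
  exists (xi : probability (V * V)%type R) (theta : probability (V * V * V)%type R),
  [/\ P2mu mu xi, Gamma gamma xi theta,
      plan_norm xi = h * Num.sqrt (\int[P]_w sqnorm (W w)),
      pairing theta = h * \int[P]_w dotv (Y w) (W w) &
      same_measure (pushforward P (fun w => X w + h *: W w)) (expmu xi)].
Proof.
move=> h0.
have mZ := measurable_rVZ h mW; have iZ := sqintZ h iW.
have mXZ := measurable_fun_pair mX mZ.
have mXY := measurable_fun_pair mX mY.
have mXYZ := measurable_fun_pair mXY mZ.
have [xi hxi] := law_exists P mXZ.
have [theta htheta] := law_exists P mXYZ.
have m1 : measurable_fun setT (fun w : V * V * V => w.1.1).
  exact: measurableT_comp measurable_fst measurable_fst.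
have m2 : measurable_fun setT (fun w : V * V * V => w.1.2).
  exact: measurableT_comp measurable_snd measurable_fst.
have m3 : measurable_fun setT (fun w : V * V * V => w.2) by exact: measurable_snd.
have ms : measurable_fun setT (fun w : V * V => sqnorm w.2).
  by apply: measurable_sqnorm; exact: measurable_snd.
exists xi, theta; split.
- exact: law_P2mu mX mZ iX iZ Xmu hxi.
- split=> A mA.
  + by rewrite -(law_comp measurable_fst htheta mA) -(XYgamma mA).
  + rewrite -(hxi A mA).
    by rewrite -(law_comp (measurable_fun_pair m1 m3) htheta mA).
- rewrite /plan_norm (law_Rintegral mXZ hxi ms) /=.
  under eq_Rintegral do rewrite sqnormZ.
  by rewrite RintegralZl // sqrtrM ?sqr_ge0 // sqrtr_sqr gtr0_norm.
- rewrite /pairing (law_Rintegral mXYZ htheta) /=; last exact: measurable_dotv.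
  under eq_Rintegral do rewrite dotvZr.
  by rewrite RintegralZl //; exact: integrable_dotv.
- by move=> A mA; exact: (law_comp measurable_addv hxi mA).
Qed.

End test_plan.

Lemma Rintegral_legendre dO (Om : measurableType dO) (P : probability Om R)
    (W Y : Om -> V) :
  measurable_fun setT W -> measurable_fun setT Y -> sqint P W -> sqint P Y ->
  \int[P]_w legendre L (W w) (Y w) =
  - (\int[P]_w dotv (Y w) (W w)) - \int[P]_w L (W w).
Proof.
move=> mW mY iW iY.
have iL := integrable_lagrangian hL mW iW.
have iD := integrable_dotv mY mW iY iW.
rewrite RintegralB //; last first.
  by under eq_fun do rewrite dotvC; exact: integrableNR.
congr (_ - _); under eq_Rintegral do rewrite dotvC -mulN1r.
by rewrite RintegralZl // mulN1r.
Qed.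

(** Dynamic programming bounds the increment of the value below by [- h] times the integral of
    [L (W)], the superdifferential bounds it above; dividing by [h] leaves the integral of
    [legendre]. *)
Lemma hopf_lax_subsolution : viscosity_subsolution T val (hamiltonian L).
Proof.
move=> t mu r gamma; rewrite in_itv /= => /andP[t0 tT] hmu [[hg _] /= hdiff].
rewrite addrC subr_le0.
have mg1 : measurable_fun setT (fst : V * V -> V) by exact: measurable_fst.
have mg2 : measurable_fun setT (snd : V * V -> V) by exact: measurable_snd.
have ig1 := P2mu_sqint1 hg; have ig2 := P2mu_sqint2 hg.
apply: (Rintegral_hamiltonian_le hL mg2 ig2) => v mv iW.
(* The velocity is a function of the second variable of [gamma], so [gamma] itself serves as the
   probability space. *)
have mW := measurableT_comp mv mg2.
rewrite (Rintegral_legendre mW mg2 iW ig2).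
set n := Num.sqrt (\int[gamma]_w sqnorm (v w.2)).
have n0 : 0 <= n by exact: sqrtr_ge0.
apply/ler_addgt0Pr => e e0.
(* The increment in time and plan norm is [h * (1 + n)], so the error becomes [e * h]. *)
have e10 : 0 < e / (1 + n) by rewrite divr_gt0 // ltr_pwDl.
have [delta delta0 hdelta] := hdiff _ e10.
have n1 : 0 < 1 + n by rewrite ltr_pwDl.
have [h [h0 hT hd]] : exists h, [/\ 0 < h, t + h < T & h * (1 + n) < delta].
  exists (Num.min ((T - t) / 2) (delta / 2 / (1 + n))).
  rewrite lt_min !divr_gt0 ?subr_gt0 //; split=> //.
    have : Num.min ((T - t) / 2) (delta / 2 / (1 + n)) <= (T - t) / 2.
      by rewrite ge_min lexx.
    by lra.
  apply: (@le_lt_trans _ _ (delta / 2)); last by lra.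
  by rewrite -ler_pdivlMr // ge_min lexx orbT.
have idg : same_measure (pushforward gamma (fun w : V * V => (w.1, w.2))) gamma.
  by move=> A mA; rewrite /pushforward; congr (gamma _); apply/seteqP; split=> [[]|[]].
have [xi [theta [hxi hth nxi pth exi]]] :=
  test_plan mg1 mg2 mW ig1 ig2 iW hg.2 idg h0.
have := dynamic_programming hL K0 GK Gm h0 hT mg1 mW ig1 iW hg.2 exi.
have thT : t + h \in `[0, T] by rewrite in_itv /= addr_ge0 ?(ltW h0) ?(ltW hT).
have := hdelta (t + h) xi theta thT hxi hth.
have -> : t + h - t = h by rewrite addrC addKr.
rewrite nxi pth gtr0_norm // -/n (_ : h + h * n = h * (1 + n)); last by lra.
move=> /(_ hd) hsup dpp.
rewrite -(ler_pM2l h0).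
have -> : h * (r + e) = r * h + e / (1 + n) * (h * (1 + n)).
  by field; rewrite gt_eqF.
by lra.
Qed.

(** Along a nearly optimal velocity [W] the value drops by [h] times the integral of [L (W)], up to
    [e * h]. The subdifferential then bounds [r] by the integral of [legendre], hence by that of
    [H]. *)
Lemma hopf_lax_supersolution : viscosity_supersolution T val (hamiltonian L).
Proof.
move=> t mu r gamma; rewrite in_itv /= => /andP[t0 tT] hmu [[hg _] /= hdiff].
rewrite addrC subr_ge0.
have mg1 : measurable_fun setT (fst : V * V -> V) by exact: measurable_fst.
have mg2 : measurable_fun setT (snd : V * V -> V) by exact: measurable_snd.
have ig1 := P2mu_sqint1 hg; have ig2 := P2mu_sqint2 hg.
pose tau := T - t.
have tau0 : 0 < tau by rewrite subr_gt0.
have c0 := lagrangian_coer_pos hL.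
(* [N] bounds the norm of every velocity plan that is optimal up to [1]. *)
pose N := ((val t mu + 1 - m) / tau + C) / c + 1.
(* [1 + |N|] comes from the time step and the plan norm, and 1 from near-optimality and gluing
   together. *)
suff key : forall e : R, 0 < e -> r <= relaxed (hamiltonian L) gamma + e * (2 + `|N|).
  apply/ler_addgt0Pr => e e0.
  have N2 : 0 < 2 + `|N| by rewrite ltr_pwDl.
  by have := key (e / (2 + `|N|)); rewrite divfK ?gt_eqF //; apply; rewrite divr_gt0.
move=> e e0.
have [delta delta0 hdelta] := hdiff _ e0.
have N1 : 0 < 1 + `|N| by rewrite ltr_pwDl.
(* [h * e <= 1] makes the plan chosen below optimal up to 1, so that [N] bounds it uniformly in
   [h]. *)
have [h [h0 hT hd he]] : exists h,
    [/\ 0 < h, t + h < T, h * (1 + `|N|) < delta & h * e <= 1].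
  set h := Num.min (tau / 2) (Num.min (delta / 2 / (1 + `|N|)) e^-1).
  have h1 : h <= tau / 2 by rewrite ge_min lexx.
  have h2 : h <= delta / 2 / (1 + `|N|) by rewrite !ge_min lexx orbT.
  have h3 : h <= e^-1 by rewrite !ge_min lexx !orbT.
  exists h; split.
  - by rewrite !lt_min !divr_gt0 // invr_gt0.
  - by move: h1; rewrite /tau; lra.
  - apply: (@le_lt_trans _ _ (delta / 2)); last by lra.
    by rewrite -ler_pdivlMr.
  - by rewrite -ler_pdivlMr // mul1r.
have eh0 : 0 < e * h / 2 by rewrite divr_gt0 // mulr_gt0.
have [xi [nu [hxi xinu near]]] := hopf_lax_near hL Gm tT hmu eh0.
pose k := e * h / 2 / (K + 1).
have K1 : 0 < K + 1 by rewrite ltr_wpDl.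
have k0 : 0 < k by rewrite divr_gt0.
have Kk : K * k <= e * h / 2.
  by rewrite /k mulrCA ler_piMr ?(ltW eh0) // ler_pdivrMr // mul1r lerDl.
have same_foot A : measurable A -> gamma (fst @^-1` A) = xi (fst @^-1` A).
  by move=> mA; rewrite [LHS](hg.2 A mA) -(hxi.2 A mA).
have k2 : 0 < k ^+ 2 by rewrite exprn_gt0.
(* [gamma] and [xi] share the foot law [mu]; the test plan takes its foot and momentum from [gamma]
   and only its velocity from [xi]. *)
have [Th [Th1 Th2 Thk]] := approx_gluing mg1 mg1 same_foot k2.
have mT1 : measurable_fun setT (fst : (V * V) * (V * V) -> V * V) by exact: measurable_fst.
have mT2 : measurable_fun setT (snd : (V * V) * (V * V) -> V * V) by exact: measurable_snd.
have mX := measurableT_comp mg1 mT1.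
have mY := measurableT_comp mg2 mT1.
have mX' := measurableT_comp mg1 mT2.
have mW := measurableT_comp mg2 mT2.
have iX := sqint_law mT1 Th1 mg1 ig1.
have iY := sqint_law mT1 Th1 mg2 ig2.
have iX' := sqint_law mT2 Th2 mg1 (P2mu_sqint1 hxi).
have iW := sqint_law mT2 Th2 mg2 (P2mu_sqint2 hxi).
have Xmu : same_measure (pushforward Th (fst \o fst)) mu.
  by move=> A mA; rewrite (law_comp mg1 Th1 mA) -(hg.2 A mA).
have XYg : same_measure (pushforward Th (fun w => (w.1.1, w.1.2))) gamma.
  move=> A mA; rewrite -(Th1 A mA) /pushforward; congr (Th _).
  by apply/seteqP; split=> [[[]]|[[]]].
have [zeta [theta [hz hth nz pth ez]]] :=
  test_plan mX mY mW iX iY iW Xmu XYg h0.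
have mXtau := measurable_rVD mX (measurable_rVZ tau mW).
have iXtau := sqintD mX (measurable_rVZ tau mW) iX (sqintZ tau iW).
have mX'tau := measurable_rVD mX' (measurable_rVZ tau mW).
have iX'tau := sqintD mX' (measurable_rVZ tau mW) iX' (sqintZ tau iW).
have [nu' hnu'] := law_exists Th mXtau.
have GG : `|G nu' - G nu| <= K * k.
  apply: (G_law_lipschitz K0 GK mXtau mX'tau iXtau iX'tau hnu' _ (ltW k0)).
  - move=> A mA; rewrite -(xinu A mA).
    have mh : measurable_fun setT (fun w : V * V => w.1 + (T - t) *: w.2).
      exact: measurable_rVD mg1 (measurable_rVZ _ mg2).
    by rewrite -(law_comp mh Th2 mA).
  - apply: le_trans Thk; rewrite le_eqVlt; apply/orP; left; apply/eqP.
    apply: eq_integral => w _; congr (sqnorm _)%:E.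
    by rewrite /= opprD addrACA subrr addr0.
have mXh := measurable_rVD mX (measurable_rVZ h mW).
have iXh := sqintD mX (measurable_rVZ h mW) iX (sqintZ h iW).
have tauh : T - (t + h) = tau - h by rewrite opprD addrA.
(* Keeping the velocity for the remaining time [tau - h] leads to the same endpoint [X + tau W]. *)
have step : val (t + h) (expmu zeta) <=
    G nu' + (tau - h) * \int[Th]_w L (w.2.2).
  rewrite -tauh; apply: (hopf_lax_le hL K0 GK Gm hT mXh mW iXh iW ez (nu := nu')).
  move=> A mA; rewrite -(hnu' A mA) tauh /pushforward.
  congr (Th (_ @^-1` A)); apply/funext => w.
  by rewrite -addrA -scalerDl [h + _]addrC subrK.
have xiL : \int[xi]_w L w.2 = \int[Th]_w L w.2.2.
  by rewrite (law_Rintegral mT2 Th2 (F := fun w => L w.2)) //; exact: measurableT_comp.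
rewrite xiL -/tau in near.
have nN : Num.sqrt (\int[Th]_w sqnorm (w.2.2)) <= `|N|.
  have Lge := Rintegral_lagrangian_ge hL mW iW.
  have Gnu : m <= G nu.
    apply: Gm; apply: law_P2 xinu.
    - exact: measurable_rVD mg1 (measurable_rVZ _ mg2).
    - apply: sqintD => //; first exact: measurable_rVZ.
      + exact: P2mu_sqint1 hxi.
      + exact/sqintZ/(P2mu_sqint2 hxi).
  apply: le_trans (ler_norm _); rewrite /N.
  set I := \int[Th]_w sqnorm w.2.2 in Lge *.
  have I0 : 0 <= I by exact: Rintegral_sqnorm_ge0.
  (* Coercivity bounds [I] by the integral of [L], which near-optimality and [m <= G nu] bound in
     turn. *)
  have IL : I <= ((val t mu + 1 - m) / tau + C) / c.
    rewrite ler_pdivlMr // mulrC -lerBlDr; apply: le_trans Lge _.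
    by rewrite ler_pdivlMr // mulrC; clear -hL K0 GK Gm mL T he near Gnu e0 h0; lra.
  (* The square root of [I] is at most [I + 1], whence the 1 added in [N]. *)
  apply: (@le_trans _ _ (I + 1)); last by rewrite lerD2r.
  rewrite -[leRHS]ger0_norm ?addr_ge0 // -sqrtr_sqr ler_sqrt ?sqr_ge0 //.
  by rewrite sqrrD1 -addrA addrCA mulr2n -addrA lerDl !addr_ge0 ?sqr_ge0.
have thT : t + h \in `[0, T] by rewrite in_itv /= addr_ge0 ?(ltW h0) ?(ltW hT).
have hn : h + h * Num.sqrt (\int[Th]_w sqnorm (w.2.2)) <= h * (1 + `|N|).
  by rewrite mulrDr mulr1 lerD2l ler_pM2l.
have := hdelta (t + h) zeta theta thT hz hth.
have -> : t + h - t = h by rewrite addrC addKr.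
rewrite nz pth gtr0_norm // => /(_ (le_lt_trans hn hd)) hsub.
have ileg := integrable_legendre hL mW mY iW iY.
have HY : \int[Th]_w legendre L w.2.2 w.1.2 <= relaxed (hamiltonian L) gamma.
  rewrite /relaxed (law_Rintegral mT1 Th1 (F := fun w => hamiltonian L w.2)); last first.
    exact: measurableT_comp (measurable_hamiltonian hL) mg2.
  apply: le_Rintegral => //; first exact: (integrable_hamiltonian hL mY iY).
  by move=> w _; exact: (fenchel_young hL).
rewrite (Rintegral_legendre mW mY iW iY) /= in HY.
apply: le_trans _ (lerD HY (lexx _)).
rewrite -(ler_pM2l h0); move: GG; rewrite ler_norml => /andP[_ GG].
have := ler_wpM2l (ltW e0) hn.
by move: hsub near step GG Kk => /=; clear -hL K0 GK Gm mL T; lra.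
Qed.

End viscosity.

(** * The theorem from its stated hypotheses *)

Unset Implicit Arguments.

Theorem mainTheorem2 (R : realType) (d : nat) (T : R)
    (G : probability 'rV[R]_d R -> R) (L : 'rV[R]_d -> R) (C c : R)
    (hT : 0 < T)
    (hGlip : W2_lipschitz G) (hGbound : bounded_below G)
    (hLconvex : convex_function [set: convex_lmodType 'rV[R]_d] L)
    (hLsuper : superlinear L) (hLquad : quadratic_growth L)
    (hL0 : L 0 = 0)
    (hC : 0 < C) (hc : 0 < c)
    (hLcoercive : forall z, c * enorm z ^+ 2 - C <= L z) :
  viscosity_solution T (hopf_lax T G L) (hamiltonian L).
Proof.
have [B hB] := hLquad; have [K hK] := hGlip; have [m hm] := hGbound.
have hL : coercive_lagrangian L B c C.
  split=> //.
  - move=> t x y /andP[t0 t1].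
    have := hLconvex (Itv01 t0 t1) x y; rewrite !inE => /(_ Logic.I Logic.I).
    by [].
  - by move=> z; rewrite -enormE.
  - by move=> z; rewrite -enormE.
(* The given Lipschitz constant has no sign; since [W2] is nonnegative, it can be raised to at least
   0. *)
have K0 : 0 <= Num.max K 0 by rewrite le_max lexx orbT.
have GK (mu nu : probability 'rV[R]_d R) : P2 mu -> P2 nu ->
    (`|G mu - G nu|%:E <= (Num.max K 0)%:E * W2 mu nu)%E.
  move=> hmu hnu; apply: le_trans (hK _ _ hmu hnu) _.
  by apply: lee_wpmul2r; rewrite ?W2_ge0 // lee_fin le_max lexx.
split; first exact: hopf_lax_subsolution hL K0 GK hm.
exact: hopf_lax_supersolution hL K0 GK hm.
Qed.
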